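(* Let $T$ be a tree with diameter $d$. Then $m_{T}[0,1)\geq \lceil (d+1)/3\rceil$.
   Context: For a graph $G$, the Laplacian matrix is $L(G)=D(G)-A(G)$ (degree diagonal matrix minus adjacency matrix), and $m_G[0,1)$ denotes the number of eigenvalues of $L(G)$, counted with multiplicity, lying in $[0,1)$. *)

(* Defs.v *)
From HB Require Import structures.
From mathcomp Require Import all_boot all_order all_algebra.
From mathcomp Require Import polyrcf.
From mathcomp Require Import reals.

Set Implicit Arguments.
Unset Strict Implicit.
Unset Printing Implicit Defensive.

Import Order.TTheory GRing.Theory Num.Theory.
Local Open Scope ring_scope.

Record sgraph := SGraph {
  vertex :> finType;
  adj : rel vertex;
  adj_sym : symmetric adj;
  adj_irrefl : irreflexive adj }.

Definition connected_graph (G : sgraph) : Prop :=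
  (0 < #|G|)%N /\ forall x y : G, connect (@adj G) x y.

(* [:: x; y] is a ucycle as soon as x and y are adjacent, hence the length
   restriction: a cycle of a simple graph has at least three vertices. *)
Definition acyclic_graph (G : sgraph) : Prop :=
  forall c : seq G, ucycle (@adj G) c -> (size c <= 2)%N.

Definition is_tree (G : sgraph) : Prop :=
  connected_graph G /\ acyclic_graph G.

Definition walk_of_length (G : sgraph) (x y : G) (k : nat) : bool :=
  [exists p : k.-tuple G, path (@adj G) x p && (last x p == y)].

(* The least length of a walk from x to y; a shortest walk has length less
   than #|G|, and the junk value #|G| is taken when there is no walk. *)
Definition gdist (G : sgraph) (x y : G) : nat :=
  find (walk_of_length x y) (iota 0 #|G|).

Definition diameter (G : sgraph) : nat :=
  (\max_(x : G) \max_(y : G) gdist x y)%N.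

Definition degree (G : sgraph) (x : G) : nat := #|[set y : G | adj x y]|.

(* Rows and columns are indexed by the vertices through enum_val. *)
Definition adjacency_mx (R : pzRingType) (G : sgraph) : 'M[R]_#|G| :=
  \matrix_(i, j) (adj (enum_val i) (enum_val j))%:R.

Definition degree_mx (R : pzRingType) (G : sgraph) : 'M[R]_#|G| :=
  diag_mx (\row_i (degree (enum_val i))%:R).

Definition laplacian_mx (R : pzRingType) (G : sgraph) : 'M[R]_#|G| :=
  degree_mx R G - adjacency_mx R G.

(* rootsR p lists the distinct real roots of p, mup gives their
   multiplicities. *)
Definition num_eigenvalues_in (R : rcfType) (n : nat) (A : 'M[R]_n)
    (I : interval R) : nat :=
  (\sum_(x <- rootsR (char_poly A) | x \in I) mup x (char_poly A))%N.

(* Main.v *)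
Require Import Defs.
From HB Require Import structures.
From mathcomp Require Import all_boot all_order all_algebra.
From mathcomp Require Import polyrcf complex.
From mathcomp Require Import reals ring zify.

(* Let [p 0, ..., p (3 * k)] be a path of the tree with [k = d %/ 3].  Collapsing
   each branch hanging from the path to its attachment vertex extends a function
   [f] on the path to the tree without changing its Dirichlet energy
   [\sum_i |f i - f i.+1|^2] and without decreasing its norm.  For [y] in
   [C^(k+1)], take [f] equal to [y j], [y j], [y j + y j.+1] at [3j], [3j+1],
   [3j+2]: norm minus energy is then [|y 0|^2 + \sum_j |y j + y j.+1|^2], which
   is positive unless [y = 0].  So the Laplacian form is smaller than the norm on
   a space of dimension [k + 1 = ceil ((d + 1) / 3)], and that many eigenvalues
   are less than [1].  The spectral theorem is applied over [R[i]]. *)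

Import Order.TTheory GRing.Theory Num.Theory.
Local Open Scope ring_scope.
Local Open Scope sesquilinear_scope.
Local Open Scope complex_scope.

(** * Hermitian forms and the number of eigenvalues below a bound *)

Lemma rank_diag_mx_le (K : fieldType) (n : nat) (c : 'rV[K]_n) :
  (\rank (diag_mx c) <= #|[pred i | c 0%R i != 0%R]|)%N.
Proof.
rewrite -sum1_card.
have -> : diag_mx c = \sum_(i | c 0 i != 0) c 0 i *: delta_mx i i.
  rewrite diag_mx_sum_delta (bigID (fun i => c 0 i != 0)) /=.
  rewrite [X in _ + X]big1 ?addr0 //.
  by move=> i /negbNE/eqP ->; rewrite scale0r.
elim/big_rec2: _ => [|i m B _ IH]; first by rewrite mxrank0.
apply: leq_trans (mxrank_add _ _) _; apply: leq_add => //.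
by apply: leq_trans (mxrank_scale _ _) _; rewrite mxrank_delta.
Qed.

Section SpectralCounting.
Variables (C : numClosedFieldType) (n : nat) (A : 'M[C]_n).
Hypothesis hermA : A \is hermsymmx.

Let P := spectralmx A.
Let a i := spectral_diag A 0 i.

Lemma sqnorm_spectral (x : 'rV[C]_n) :
  (x *m x^t*) 0 0 = \sum_i `|(x *m P^t*) 0 i| ^+ 2.
Proof.
have PP : P^t* *m P = 1%:M.
  by rewrite -invmx_unitary ?spectral_unitarymx // mulVmx // spectral_unit.
transitivity (((x *m P^t*) *m (x *m P^t*)^t*) 0 0).
  by rewrite trmx_mul map_mxM trmxCK mulmxA -(mulmxA x) PP mulmx1.
by rewrite mxE; apply: eq_bigr => i _; rewrite !mxE normCK.
Qed.

Lemma quadratic_form_spectral (x : 'rV[C]_n) :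
  (x *m A *m x^t*) 0 0 = \sum_i a i * `|(x *m P^t*) 0 i| ^+ 2.
Proof.
have /orthomx_spectralP -> := hermitian_normalmx hermA.
rewrite -/P invmx_unitary ?spectral_unitarymx //.
transitivity (((x *m P^t*) *m diag_mx (spectral_diag A) *m (x *m P^t*)^t*) 0 0).
  by rewrite trmx_mul map_mxM trmxCK !mulmxA.
rewrite mul_mx_diag mxE; apply: eq_bigr => i _.
by rewrite !mxE normCK mulrAC mulrC.
Qed.

Lemma spectral_diag_ge0 (i : 'I_n) :
  (forall x : 'rV[C]_n, 0 <= (x *m A *m x^t*) 0 0) -> 0 <= a i.
Proof.
move=> /(_ (row i P)); rewrite quadratic_form_spectral.
have -> : row i P *m P^t* = delta_mx 0 i.
  by rewrite -row_mul (unitarymxP (spectral_unitarymx A)) row1.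
rewrite (bigD1 i) //= big1 ?addr0 => [|j /negPf ji].
  by rewrite !mxE !eqxx normr1 expr1n mulr1.
by rewrite !mxE ji andbF normr0 expr0n mulr0.
Qed.

Lemma spectral_diag_real (i : 'I_n) : a i \is Num.real.
Proof. by have /mxOverP := hermitian_spectral_diag_real hermA; apply. Qed.

(* The span of the eigenvectors with eigenvalue at least [c] has codimension
   the right-hand side, so it would meet a larger row space of [B]. *)
Lemma le_card_spectral_lt (c : C) (m : nat) (B : 'M[C]_(m, n)) :
    c \is Num.real ->
    (forall y : 'rV[C]_m, y != 0 ->
       (y *m B *m A *m (y *m B)^t*) 0 0 < c * (y *m B *m (y *m B)^t*) 0 0) ->
  (m <= #|[pred i | (a i < c)%R]|)%N.
Proof.
move=> creal Blt; rewrite leqNgt; apply/negP => ltm.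
(* [D] keeps the spectral coordinates with eigenvalue below [c]; there are fewer than [m] of them,
   so some nonzero [y] has all of these coordinates equal to zero. *)
pose D := diag_mx (\row_i (a i < c)%R%:R : 'rV[C]_n).
have /rowV0Pn[y /sub_kermxP yM0 y0] : kermx (B *m P^t* *m D) != 0.
  rewrite kermx_eq0 /row_free neq_ltn; apply/orP; left.
  apply: leq_ltn_trans (mxrankM_maxr _ _) _.
  apply: leq_ltn_trans (rank_diag_mx_le _ _ _) _.
  apply: leq_ltn_trans ltm; rewrite subset_leq_card //.
  by apply/subsetP => i; rewrite !inE mxE pnatr_eq0 eqb0 negbK.
have z0 i : a i < c -> (y *m B *m P^t*) 0 i = 0.
  move=> ai; move/rowP/(_ i): yM0; rewrite !mulmxA mul_mx_diag !mxE.
  by rewrite ai mulr1.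
have := Blt y y0; rewrite quadratic_form_spectral sqnorm_spectral mulr_sumr.
apply/negP; rewrite -real_leNgt; first last.
- by apply: rpred_sum => i _; rewrite rpredM ?spectral_diag_real// ger0_real ?exprn_ge0.
- by apply: rpred_sum => i _; rewrite rpredM // ger0_real ?exprn_ge0.
apply: ler_sum => i _; have [/z0->|] := real_ltP (spectral_diag_real i) creal.
  by rewrite normr0 expr0n !mulr0.
by move=> ca; rewrite ler_wpM2r // exprn_ge0.
Qed.

End SpectralCounting.

(** * Roots of the characteristic polynomial and the spectral diagonal *)

Lemma char_poly_conj (K : fieldType) (n : nat) (Q A : 'M[K]_n) :
  Q \in unitmx -> char_poly (invmx Q *m A *m Q) = char_poly A.
Proof.
move=> Qu; rewrite /char_poly /char_poly_mx.
have QQ : map_mx polyC (invmx Q) *m map_mx polyC Q = 1%:M.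
  by rewrite -map_mxM mulVmx // map_mx1.
have -> : 'X%:M - map_mx polyC (invmx Q *m A *m Q) =
    map_mx polyC (invmx Q) *m ('X%:M - map_mx polyC A) *m map_mx polyC Q.
  rewrite mulmxBr mulmxBl -!map_mxM; congr (_ - _).
  by rewrite scalar_mxC -mulmxA QQ mulmx1.
by rewrite !det_mulmx mulrAC -det_mulmx QQ det1 mul1r.
Qed.

(** After exchanging the two sums, each index [i] is counted at the single root [b i], provided that
    this root lies in [I]. *)
Lemma num_eigenvalues_in_prod (R : rcfType) (n : nat) (A : 'M[R]_n)
    (b : 'I_n -> R) (I : interval R) :
    char_poly A = \prod_i ('X - (b i)%:P) ->
  num_eigenvalues_in A I = #|[pred i | b i \in I]|.
Proof.
move=> Ab; rewrite /num_eigenvalues_in.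
have Ap : char_poly A = \prod_(y <- codom b) ('X - y%:P).
  by rewrite Ab big_map big_enum.
have p0 : char_poly A != 0 by rewrite monic_neq0 // char_poly_monic.
under eq_bigr do rewrite Ap mu_prod_XsubC -sum1_count big_map big_enum_cond.
rewrite (exchange_big_dep predT) //= -sum1_card [RHS]big_mkcond /=.
apply: eq_bigr => i _; have bi : b i \in rootsR (char_poly A).
  by rewrite -(roots_on_rootsR p0) /= Ap root_prod_XsubC codom_f.
rewrite inE; have [bI|bI] := boolP (b i \in I).
  rewrite (big_rem _ bi) /= bI eqxx /= big_seq_cond big1 // => x.
  case/andP=> xr /andP[_ /eqP bx]; move: xr.
  by rewrite mem_rem_uniq ?uniq_roots // !inE bx eqxx.
by rewrite big1 // => x /andP[xI /eqP bx]; rewrite bx xI in bI.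
Qed.

Lemma sym_map_hermsym (R : rcfType) (n : nat) (A : 'M[R]_n) :
  A^T = A -> map_mx (real_complex R) A \is hermsymmx.
Proof.
move=> symA; apply: realsym_hermsym; last first.
  by apply/mxOverP => i j; rewrite mxE; apply/complex_realP; exists (A i j).
by apply/is_hermitianmxP; rewrite expr0 scale1r map_mx_id // map_trmx symA.
Qed.

Lemma num_eigenvalues_in_spectral (R : rcfType) (n : nat) (A : 'M[R]_n)
    (I : interval R) :
    A^T = A ->
  num_eigenvalues_in A I =
    #|[pred i | complex.Re (spectral_diag (map_mx (real_complex R) A) 0 i) \in I]|.
Proof.
move=> symA; apply: num_eigenvalues_in_prod.
have hermA := sym_map_hermsym _ _ _ symA; set AC := map_mx _ A in hermA *.
(* The spectral diagonal of a Hermitian matrix is real, so the factorization over [R[i]] descends to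
   [R]. *)
apply: (map_poly_inj (real_complex R)).
rewrite map_char_poly -/AC rmorph_prod /=.
have /orthomx_spectralP eA := hermitian_normalmx hermA.
rewrite [in LHS]eA char_poly_conj ?spectral_unit // char_poly_trig ?diag_mx_is_trig //.
apply: eq_bigr => i _; rewrite map_polyXsubC /= RRe_real ?spectral_diag_real //.
by rewrite mxE eqxx mulr1n.
Qed.

(** * The quadratic form of the Laplacian *)

Section LaplacianForm.
Variables (C : numClosedFieldType) (G : sgraph).

(** The right-hand side runs over ordered pairs and meets each edge twice, hence the doubling. *)
Lemma laplacian_formE (x : 'rV[C]_#|G|) :
  (x *m laplacian_mx C G *m x^t*) 0 0 *+ 2 =
    \sum_i \sum_(j | adj (enum_val i) (enum_val j)) `|x 0 i - x 0 j| ^+ 2.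
Proof.
pose S (F : 'I_#|G| -> 'I_#|G| -> C) :=
  \sum_i \sum_(j | adj (enum_val i) (enum_val j)) F i j.
have Ssym F : S F = S (fun i j => F j i).
  rewrite /S (exchange_big_dep predT) //=; apply: eq_bigr => i _.
  by apply: eq_bigl => j; rewrite adj_sym.
have SB F F' : S (fun i j => F i j - F' i j) = S F - S F'.
  by rewrite /S -sumrB; apply: eq_bigr => i _; rewrite sumrB.
pose F1 i (j : 'I_#|G|) := `|x 0 i| ^+ 2; pose F2 i j := x 0 i * (x 0 j)^*.
have -> : (x *m laplacian_mx C G *m x^t*) 0 0 =
    S F1 - S F2.
  rewrite /laplacian_mx mulmxBr mulmxBl mxE; congr (_ + _).
    rewrite mul_mx_diag mxE; apply: eq_bigr => i _.
    rewrite !mxE sumr_const mulrAC -normCK mulr_natr /degree; congr (_ *+ _).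
    rewrite -(card_imset _ enum_val_inj); apply: eq_card => v; rewrite inE.
    apply/idP/imsetP => [iv|[j ? ->//]].
    by exists (enum_rank v); rewrite ?unfold_in /= enum_rankK.
  rewrite mxE mxE; congr (- _).
  transitivity (\sum_j \sum_(i | adj (enum_val i) (enum_val j)) x 0 i * (x 0 j)^*).
    apply: eq_bigr => j _; rewrite !mxE mulr_suml [RHS]big_mkcond; apply: eq_bigr => i _.
    by rewrite !mxE; case: ifP => _; rewrite ?mulr1 ?mulr0 ?mul0r.
  by rewrite (exchange_big_dep predT).
(* Adding to [S F1 - S F2] its copy with the indices exchanged turns each summand into the expansion
   of [|x i - x j|^2]. *)
rewrite mulr2n {2}(Ssym F1) {2}(Ssym F2) -!SB -big_split; apply: eq_bigr => i _.
rewrite -big_split; apply: eq_bigr => j _.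
by rewrite /F1 /F2 /= !normCK rmorphB /=; ring.
Qed.

Lemma laplacian_form_ge0 (x : 'rV[C]_#|G|) :
  0 <= (x *m laplacian_mx C G *m x^t*) 0 0.
Proof.
rewrite -(pmulrn_lge0 _ (ltn0Sn 1)) laplacian_formE.
by do 2!apply: sumr_ge0 => ? _; rewrite exprn_ge0.
Qed.

End LaplacianForm.

(** * Projection of an acyclic graph onto a path *)

Definition remove_edge {G : sgraph} (a b : G) : rel G :=
  fun u v => [&& adj u v, (u, v) != (a, b) & (u, v) != (b, a)].

Lemma remove_edge_sym (G : sgraph) (a b : G) : symmetric (remove_edge a b).
Proof.
move=> u v; rewrite /remove_edge adj_sym !xpair_eqE.
by rewrite [(v == b) && _]andbC [(v == a) && _]andbC; congr (_ && _); rewrite andbC.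
Qed.

(** A simple path from [b] to [a] avoiding the edge would close up with it into a cycle. *)
Lemma acyclic_bridge (G : sgraph) (a b : G) :
  acyclic_graph G -> adj a b -> ~~ connect (remove_edge a b) b a.
Proof.
move=> acG ab; apply/negP => /connectP[s bs lst].
case/shortenP: bs lst => {}s bs us _ lst.
have /acG : ucycle (@adj G) (b :: s).
  rewrite /ucycle us andbT /= rcons_path -lst ab andbT.
  by apply: sub_path bs => u v /and3P[].
(* Acyclicity leaves only paths with at most one edge: the empty one would make the edge a loop, and
   a single edge would be the removed one. *)
case: s bs us lst => [|c [|d s]] //=; first by move=> _ _ ba; rewrite ba adj_irrefl in ab.
by rewrite /remove_edge => + _ ac; rewrite -ac eqxx !andbF.
Qed.

Section PathProjection.
Variables (G : sgraph) (N : nat) (p : nat -> G).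
Hypothesis acG : acyclic_graph G.
Hypothesis padj : forall i, (i < N)%N -> adj (p i) (p i.+1).
Hypothesis pinj : {in gtn N.+1 &, injective p}.

Definition far_side (i : nat) (v : G) : bool :=
  connect (remove_edge (p i) (p i.+1)) (p i.+1) v.

(* The index of the path vertex at which the branch of [v] is attached. *)
Definition path_proj (v : G) : nat := \sum_(i < N) far_side i v.

Lemma far_side_edge (i : nat) (u v : G) :
  remove_edge (p i) (p i.+1) u v -> far_side i u = far_side i v.
Proof.
by move=> uv; apply: same_connect_r; [apply/sym_connect_sym/remove_edge_sym|exact: connect1].
Qed.

Lemma remove_edge_path (i j : nat) :
  (i < N)%N -> (j < N)%N -> j != i ->
  remove_edge (p i) (p i.+1) (p j) (p j.+1).
Proof.
move=> iN jN ji; rewrite /remove_edge padj //= !xpair_eqE.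
by rewrite !(inj_in_eq pinj) ?inE; lia.
Qed.

(** The other path edges survive the removal of the [i]-th, so [far_side i] is constant on each half
    of the path; the bridge property separates the halves. *)
Lemma far_side_path (i j : nat) :
  (i < N)%N -> (j <= N)%N -> far_side i (p j) = (i < j)%N.
Proof.
move=> iN jN; have bridge : ~~ far_side i (p i).
  exact/acyclic_bridge/padj.
case: ltnP => ij.
  elim: j ij jN => // j IH; rewrite ltnS leq_eqVlt => /predU1P[<- _|ij jN].
    exact: connect0.
  rewrite -(IH ij (ltnW jN)); apply/esym/far_side_edge/remove_edge_path => //; lia.
rewrite -(negbTE bridge).
have: forall m, (m <= i)%N -> far_side i (p (i - m)) = far_side i (p i).
  elim=> [_|m IH mi]; first by rewrite subn0.
  rewrite -IH; last exact: ltnW.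
  have -> : (i - m = (i - m.+1).+1)%N by lia.
  apply/far_side_edge/remove_edge_path; lia.
by move/(_ (i - j)%N); rewrite subKn // leq_subr => ->.
Qed.

Lemma path_proj_path (j : nat) : (j <= N)%N -> path_proj (p j) = j.
Proof.
move=> jN; transitivity (\sum_(i < N | (i < j)%N) 1)%N.
  by rewrite big_mkcond; apply: eq_bigr => i _; rewrite far_side_path //; case: ltnP.
by rewrite -(big_ord_widen _ (fun=> 1%N)) // sum1_card card_ord.
Qed.

(** An edge off the path survives every removal, so its ends are on the same side each time and the
    two sums agree term by term. *)
Lemma path_proj_edge (u v : G) : adj u v -> path_proj u != path_proj v ->
  exists i : 'I_N, (u, v) = (p i, p i.+1) \/ (u, v) = (p i.+1, p i).
Proof.
move=> uv; pose e (i : 'I_N) := ((u, v) == (p i, p i.+1)) || ((u, v) == (p i.+1, p i)).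
have [/existsP[i /orP[]/eqP ->] _|] := boolP [exists i, e i].
- by exists i; left.
- by exists i; right.
move=> noi /eqP[]; apply: eq_bigr => i _; congr nat_of_bool.
apply: far_side_edge; rewrite /remove_edge uv /= -negb_or.
by apply: contra noi => ei; apply/existsP; exists i.
Qed.

Lemma path_proj_energy_le (K : numDomainType) (f : nat -> K) :
  \sum_u \sum_(v | adj u v) `|f (path_proj u) - f (path_proj v)| ^+ 2 <=
    (\sum_(i < N) `|f i - f i.+1| ^+ 2) *+ 2.
Proof.
pose g (i : 'I_N) : K := `|f i - f i.+1| ^+ 2.
(* [e i w] counts the orientations of the [i]-th path edge that equal [w]; its sum over [w] is 2,
   which gives the factor in the bound. *)
pose e (i : 'I_N) (w : G * G) : nat := ((w == (p i, p i.+1)) + (w == (p i.+1, p i)))%N.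
have g0 i : 0 <= g i by rewrite exprn_ge0.
rewrite pair_big_dep /=.
apply: (@le_trans _ _ (\sum_w \sum_i g i *+ e i w)).
  rewrite big_mkcond; apply: ler_sum => -[u v] _ /=.
  have S0 : 0 <= \sum_i g i *+ e i (u, v).
    by apply: sumr_ge0 => i _; rewrite mulrn_wge0.
  case: ifP => // uv; have [->|/(path_proj_edge _ _ uv)[i E]] := eqVneq (path_proj u) (path_proj v).
    by rewrite subrr normr0 expr0n.
  rewrite (bigD1 i) //=; apply: ler_wpDr.
    by apply: sumr_ge0 => j _; rewrite mulrn_wge0.
  have -> : `|f (path_proj u) - f (path_proj v)| ^+ 2 = g i.
    have [iN iN'] : (i <= N)%N /\ (i.+1 <= N)%N by split; first exact: ltnW.
    by case: E => -[-> ->]; rewrite !path_proj_path // distrC.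
  have e1 : (1 <= e i (u, v))%N.
    by rewrite /e addn_gt0 !lt0b; case: E => ->; rewrite eqxx ?orbT.
  by rewrite -(subnKC e1) mulrnDr mulr1n lerDl mulrn_wge0.
rewrite exchange_big -sumrMnl; apply: ler_sum => i _.
have sum_eq (c : G * G) : (\sum_w (w == c) = 1)%N.
  by rewrite (bigD1 c) //= eqxx big1 // => w /negPf->.
by rewrite sumrMnr big_split /= !sum_eq.
Qed.

(** The path vertices alone contribute the left-hand side, each projecting to its own index. *)
Lemma path_proj_sqnorm_ge (K : numDomainType) (f : nat -> K) :
  \sum_(j < N.+1) `|f j| ^+ 2 <= \sum_v `|f (path_proj v)| ^+ 2.
Proof.
have qinj : injective (fun j : 'I_N.+1 => p j).
  by move=> i j /(pinj _ _ (ltn_ord i) (ltn_ord j)) /val_inj.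
rewrite [leRHS](bigID (mem [set p j | j : 'I_N.+1])) /= big_imset /=; last first.
  by move=> i j _ _; apply: qinj.
rewrite [X in X + _](eq_bigr (fun j : 'I_N.+1 => `|f j| ^+ 2)) => [|j _]; last first.
  by rewrite path_proj_path // -ltnS.
by rewrite lerDl; apply: sumr_ge0 => v _; rewrite exprn_ge0.
Qed.

End PathProjection.

(** * Test functions on the path *)

(* The test vectors are chosen so that on the [j]-th block of three path edges
   the increments are [0], [y j.+1] and [- y j]. *)
Definition path_test {K : pzRingType} (y : nat -> K) (i : nat) : K :=
  y (i %/ 3)%N + (if (i %% 3 == 2)%N then y (i %/ 3).+1 else 0).

Lemma path_test_block (K : pzRingType) (y : nat -> K) (j : nat) :
  [/\ path_test y (3 * j) = y j, path_test y (3 * j).+1 = y j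
    & path_test y (3 * j).+2 = y j + y j.+1].
Proof.
have E r : (r < 3)%N -> path_test y (3 * j + r) = y j + (if r == 2 then y j.+1 else 0).
  move=> r3; rewrite /path_test mulnC divnMDl // modnMDl.
  by rewrite divn_small // modn_small // addn0.
by split; [rewrite -[(3 * j)%N]addn0 | rewrite -addn1 | rewrite -addn2];
  rewrite E //= addr0.
Qed.

(** By induction on [k]: the new energy terms [0], [|y k.+1|^2], [|y k|^2] cancel the new squares at
    [3k+3] and [3k+1], leaving the one at [3k+2]. *)
Lemma path_test_sqnorm_sub_energy (K : numDomainType) (y : nat -> K) (k : nat) :
  \sum_(i < (3 * k).+1) `|path_test y i| ^+ 2 -
    \sum_(i < 3 * k) `|path_test y i - path_test y i.+1| ^+ 2 =
  `|y 0%N| ^+ 2 + \sum_(j < k) `|y j + y j.+1| ^+ 2.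
Proof.
elim: k => [|k IH].
  by rewrite muln0 big_ord1 !big_ord0 /path_test /= !addr0 subr0.
have [E0 E1 E2] := path_test_block K y k; have [E3 _ _] := path_test_block K y k.+1.
rewrite mulnSr addn3 in E3 *.
rewrite [in RHS]big_ord_recr /= addrA -IH.
have recr3 (F : nat -> K) m : \sum_(i < m.+3) F i = \sum_(i < m) F i + F m + F m.+1 + F m.+2.
  by rewrite !big_ord_recr.
rewrite (recr3 (fun i => `|path_test y i| ^+ 2)).
rewrite (recr3 (fun i => `|path_test y i - path_test y i.+1| ^+ 2)).
rewrite E0 E1 E2 E3 subrr normr0 addrK.
rewrite (_ : y k - (y k + y k.+1) = - y k.+1) ?normrN; last by ring.
ring.
Qed.

(** If the difference vanished, [y 0] and all [y j + y j.+1] would be zero, which propagates to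
    [y j = 0] for all [j <= k]. *)
Lemma path_test_energy_lt (K : numDomainType) (y : nat -> K) (k : nat) :
  (exists2 j, (j <= k)%N & y j != 0) ->
  \sum_(i < 3 * k) `|path_test y i - path_test y i.+1| ^+ 2 <
    \sum_(i < (3 * k).+1) `|path_test y i| ^+ 2.
Proof.
move=> [j0 j0k yj0]; rewrite -subr_gt0 path_test_sqnorm_sub_energy.
have sq0 (z : K) : 0 <= `|z| ^+ 2 by rewrite exprn_ge0.
have S0 : 0 <= \sum_(j < k) `|y j + y j.+1| ^+ 2 by apply: sumr_ge0.
rewrite lt0r addr_ge0 // andbT paddr_eq0 // negb_and; apply: contraNT yj0.
rewrite negb_or !negbK sqrf_eq0 normr_eq0 psumr_eq0 // => /andP[/eqP y0 /allP ys].
elim: j0 j0k => [|j IH] jk; first by rewrite y0.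
have /eqP yj := IH (ltnW jk); have := ys (Ordinal jk) (mem_index_enum _).
by rewrite /= sqrf_eq0 normr_eq0 yj add0r.
Qed.

(** * A path as long as the diameter, the test space and the eigenvalue bound *)

Lemma diameter_path (G : sgraph) : connected_graph G ->
  exists p : nat -> G,
    (forall i, (i < diameter G)%N -> adj (p i) (p i.+1)) /\
    {in gtn (diameter G).+1 &, injective p}.
Proof.
move=> [G0 conn]; have [x dx] := @bigop.eq_bigmax G (fun x => \max_y gdist x y)%N G0.
have [y dy] := @bigop.eq_bigmax G (gdist x) G0.
have /connectP[s xs ys] := conn x y; case/shortenP: xs ys => {}s xs us _ ys.
have ds : (diameter G <= size s)%N.
  rewrite /diameter dx dy /gdist leqNgt; apply/negP => /(before_find 0%N).
  (* [gdist] only tries lengths below [#|G|]; this one is among them because the path has distinct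
     vertices. *)
  have sG : (size s < #|G|)%N by rewrite -[(size s).+1]/(size (x :: s)) -(card_uniqP us) max_card.
  rewrite nth_iota // add0n => /negbT/negP[]; apply/existsP; exists (in_tuple s).
  by rewrite /= xs ys eqxx.
exists (nth x (x :: s)); split=> [i id|i j iN jN].
  by apply: (pathP x xs); apply: leq_trans ds.
move/eqP; rewrite nth_uniq //; first by move/eqP.
- by apply: leq_trans iN _.
- by apply: leq_trans jN _.
Qed.

Lemma laplacian_test_space (C : numClosedFieldType) (G : sgraph) (k : nat) :
    is_tree G -> (3 * k <= diameter G)%N ->
  exists B : 'M[C]_(k.+1, #|G|), forall y : 'rV[C]_k.+1, y != 0 ->
    (y *m B *m laplacian_mx C G *m (y *m B)^t*) 0 0 <
      1 * (y *m B *m (y *m B)^t*) 0 0.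
Proof.
move=> [conG acG] kd; have [p [padj pinj]] := diameter_path G conG.
have {}padj i : (i < 3 * k)%N -> adj (p i) (p i.+1).
  by move=> ik; apply: padj; apply: leq_trans kd.
have {}pinj : {in gtn (3 * k).+1 &, injective p}.
  by move=> i j ik jk; apply: pinj; [apply: leq_trans ik _|apply: leq_trans jk _].
pose pi := path_proj G (3 * k) p.
(* Row [j] is the test function of the [j]-th basis vector, pulled back to the tree along the
   projection. *)
pose B : 'M[C]_(k.+1, #|G|) :=
  \matrix_(j, i) path_test (fun a => (j == a :> nat)%:R) (pi (enum_val i)).
exists B => y y0; pose Y (a : nat) : C := \sum_j y 0 j * (j == a :> nat)%:R.
have YE (j : 'I_k.+1) : Y j = y 0 j.
  rewrite /Y (bigD1 j) //= eqxx mulr1 big1 ?addr0 // => l /negPf lj.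
  by rewrite -val_eqE /= in lj; rewrite lj mulr0.
(* [path_test] is linear in [y], and [Y] is the row [y] extended by zero. *)
have BE i : (y *m B) 0 i = path_test Y (pi (enum_val i)).
  rewrite mxE /path_test /Y; under eq_bigr do rewrite mxE /path_test mulrDr.
  rewrite big_split /=; congr (_ + _).
  by case: ifP => _ //; rewrite big1 // => j _; rewrite mulr0.
have sumE (F : G -> C) : \sum_(i < #|G|) F (enum_val i) = \sum_v F v.
  by rewrite [RHS](reindex (@enum_val G predT)) //; apply/onW_bij/enum_val_bij.
have normE : (y *m B *m (y *m B)^t*) 0 0 = \sum_v `|path_test Y (pi v)| ^+ 2.
  by rewrite mxE -sumE; apply: eq_bigr => i _; rewrite !mxE -BE !mxE normCK.
rewrite mul1r -(ltr_pMn2r (ltn0Sn 1)) laplacian_formE normE.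
under eq_bigr => i _ do under eq_bigr => j _ do rewrite !BE.
have -> : \sum_(i < #|G|) \sum_(j < #|G| | adj (enum_val i) (enum_val j))
      `|path_test Y (pi (enum_val i)) - path_test Y (pi (enum_val j))| ^+ 2 =
    \sum_u \sum_(v | adj u v) `|path_test Y (pi u) - path_test Y (pi v)| ^+ 2.
  rewrite -[RHS]sumE; apply: eq_bigr => i _; rewrite big_mkcond [RHS]big_mkcond.
  by rewrite -[RHS]sumE.
apply: le_lt_trans (path_proj_energy_le _ _ _ acG padj pinj _ _) _.
rewrite ltr_pMn2r //.
apply: lt_le_trans (path_proj_sqnorm_ge _ _ _ acG padj pinj _ _).
apply: path_test_energy_lt.
have /rV0Pn[j yj] := y0; exists j; first by rewrite -ltnS.
by rewrite YE.
Qed.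

Lemma laplacian_mx_sym (K : pzRingType) (G : sgraph) :
  (laplacian_mx K G)^T = laplacian_mx K G.
Proof.
rewrite /laplacian_mx linearB /= tr_diag_mx; congr (_ - _).
by apply/matrixP => i j; rewrite !mxE adj_sym.
Qed.

Lemma map_laplacian_mx (K K' : pzRingType) (h : {rmorphism K -> K'}) (G : sgraph) :
  map_mx h (laplacian_mx K G) = laplacian_mx K' G.
Proof.
by apply/matrixP => i j; rewrite !mxE rmorphB !rmorphMn /= rmorph1.
Qed.

Theorem theorem6 (R : realType) (T : sgraph) (d : nat)
    (hT : is_tree T) (hd : diameter T = d) :
  Num.ceil (d.+1%:R / 3%:R : R)
    <= (num_eigenvalues_in (laplacian_mx R T) `[0, 1[)%:Z.
Proof.
have symL := laplacian_mx_sym R T.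
rewrite num_eigenvalues_in_spectral // map_laplacian_mx.
have hermL : laplacian_mx R[i] T \is hermsymmx.
  by rewrite -(map_laplacian_mx _ _ (real_complex R)); apply: sym_map_hermsym.
have kd : (3 * (d %/ 3) <= diameter T)%N by rewrite hd mulnC leq_trunc_div.
have [B /(le_card_spectral_lt _ _ _ hermL _ _ _ (rpred1 _)) leB] :=
  laplacian_test_space R[i] T _ hT kd.
rewrite ceil_le_int ler_pdivrMr ?ltr0n // -[_%:~R]/(_%:R) -natrM ler_nat.
(* Since [d < 3 (d %/ 3 + 1)], it is enough to find [d %/ 3 + 1] eigenvalues. *)
apply: leq_trans (_ : (d %/ 3).+1 * 3 <= _)%N; first by rewrite -ltn_divLR.
rewrite leq_mul2r /=; apply: leq_trans leB _; apply/subset_leq_card/subsetP => i.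
(* The lower end of the interval comes from the nonnegativity of the Laplacian form. *)
rewrite [in X in X -> _]inE inE => li; have l0 := spectral_diag_ge0 _ _ _ hermL i (laplacian_form_ge0 _ _).
by rewrite in_itv /= -ler0c -ltcR RRe_real ?spectral_diag_real // l0.
Qed.
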